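(* Let $A$ be an $n\times n$ matrix with entries in $\{0,1\}$ and with $\mathrm{per}(A)\neq0$, and let $r_i\neq0$ be the number of ones in the $i$-th row of $A$ ($i=1,\ldots,n$). Then for all $\alpha\geq1$, $$\ln_\alpha\bigl(\mathrm{per}(A)\bigr)\leq\sum_{i=1}^n\frac{1}{r_i}\sum_{j=1}^{r_i}\ln_\alpha(j).$$
   Context: The permanent of an $n\times n$ matrix $A=[a(i,j)]$ is $\mathrm{per}(A)=\sum_{\sigma\in S_n}\prod_{i=1}^n a(i,\sigma(i))$, where $S_n$ is the set of all permutations of $\{1,\ldots,n\}$. For $\xi>0$, the $\alpha$-logarithm is $\ln_\alpha(\xi)=\frac{\xi^{1-\alpha}-1}{1-\alpha}$ for $\alpha>0$, $\alpha\neq1$, and $\ln_1(\xi)=\ln\xi$. *)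

(* Defs.v *)
From HB Require Import structures.
From mathcomp Require Import all_boot all_order all_algebra all_fingroup.
From mathcomp Require Import reals exp.

Set Implicit Arguments.
Unset Strict Implicit.
Unset Printing Implicit Defensive.

Import Order.TTheory GRing.Theory Num.Theory.

Local Open Scope ring_scope.

Definition permanent (R : comPzSemiRingType) (n : nat) (A : 'M[R]_n) : R :=
  \sum_(s : 'S_n) \prod_(i < n) A i (s i).

Definition row_ones (R : nzRingType) (n : nat) (A : 'M[R]_n) (i : 'I_n) : nat :=
  #|[set j : 'I_n | A i j == 1]|.

(* Only meaningful for 0 < alpha and 0 < x; outside this domain the values of
   ln and powR are the conventional ones of the library. *)
Definition ln_alpha (R : realType) (alpha x : R) : R :=
  if alpha == 1 then ln x
  else (powR x (1 - alpha) - 1) / (1 - alpha).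

(* Main.v *)
Require Import Defs.
From HB Require Import structures.
From mathcomp Require Import all_boot all_order all_algebra all_fingroup.
From mathcomp Require Import reals exp.
From mathcomp Require Import ring lra.

Set Implicit Arguments.
Unset Strict Implicit.
Unset Printing Implicit Defensive.

Import Order.TTheory GRing.Theory Num.Theory.

Local Open Scope ring_scope.

(** The proof is Schrijver's induction for the Minc-Bregman inequality, the case
    [alpha = 1]; it survives for [alpha >= 1] because it needs little more of
    the logarithm than subadditivity on products of numbers at least 1
    ([ln_alphaM_le]) and concavity ([ln_alpha_tangent]).

    Let [P = per A], [f = ln_alpha alpha], [g r] the mean of [f 1, ..., f r], and
    [P i j] the permanent of the minor of [A] at [(i, j)]. For each row [i], [P] is
    the sum of the [P i j] over the ones of that row, and each [P i j] is 0 or at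
    least 1, so [ln_alpha_sum_le] gives
      [P * f P <= P * f (r i) + sum_j P i j * f (P i j)].
    By induction, [P i j * f (P i j)] is at most [P i j] times the sum of the
    [g (r' k)] over the other rows [k], where [r' k] is [r k - 1] if [A k j = 1] and [r k] otherwise.

    No single row gives the theorem, but the average over all rows [i] does. After
    [permanent_expand_row] everything is a sum over the [P] permutations [s]
    supported by the ones of [A]. For a fixed [s], row [k] contributes [f (r k)]
    once, [g (r k - 1)] for the [r k - 1] rows [i] other than [k] with
    [A k (s i) = 1], and [g (r k)] for the remaining [n - r k] rows. Since
    [f r + (r - 1) * g (r - 1) = r * g r], the total is [n * g (r k)]
    ([mean_ln_double_count]), and dividing by [n] closes the induction
    ([permanent_ln_le]). *)

(** * The deformed logarithm *)

Section LnAlpha.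
Context (R : realType) (alpha : R) (alpha_ge1 : 1 <= alpha).
Implicit Types x y : R.

Local Notation f := (ln_alpha alpha).

Lemma ln_alpha1 : f 1 = 0.
Proof. by rewrite /ln_alpha ln1 powR1 subrr mul0r if_same. Qed.

(** The deformed logarithm is not additive: the second term is damped by the
    factor [x `^ (1 - alpha)], which is at most 1 when [x >= 1] and
    [alpha >= 1]. This is the source of [ln_alphaM_le]. *)
Lemma ln_alphaM x y : 0 < x -> 0 < y -> f (x * y) = f x + x `^ (1 - alpha) * f y.
Proof.
move=> x0 y0; rewrite /ln_alpha; case: eqP => [->|/eqP a1].
  by rewrite subrr powRr0 mul1r lnM.
rewrite powRM ?ltW //; field.
by rewrite subr_eq0 eq_sym.
Qed.

(** For [alpha > 1] the bound goes through [ln x]: by [1 + t <= expR t],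
    [1 - x `^ (1 - alpha) <= (alpha - 1) * ln x]. *)
Lemma ln_alpha_le_sub1 x : 0 < x -> f x <= x - 1.
Proof.
move=> x0.
have lnx : ln x <= x - 1.
  by have := @le_ln1Dx R (x - 1); rewrite [1 + _]addrC subrK; apply; lra.
rewrite /ln_alpha; case: eqP => [//|/eqP a1].
apply: le_trans lnx.
have a_lt0 : 1 - alpha < 0 by rewrite subr_lt0 lt_def a1.
rewrite ler_ndivrMr // lerBrDl mulrC /powR gt_eqF //.
exact: expR_ge1Dx.
Qed.

(** Concavity of [ln_alpha alpha], as the tangent line at [y]; by homogeneity
    ([ln_alphaM]) it is enough to know the tangent at 1. *)
Lemma ln_alpha_tangent x y : 0 < x -> 0 < y ->
  f x <= f y + y `^ (1 - alpha) * (x / y - 1).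
Proof.
move=> x0 y0; have xy0 : 0 < x / y by rewrite divr_gt0.
rewrite -{1}[x](@divfK _ y) ?gt_eqF // [x / y * y]mulrC ln_alphaM // lerD2l.
by rewrite ler_wpM2l ?powR_ge0 // ln_alpha_le_sub1.
Qed.

Lemma ln_alpha_ge0 x : 1 <= x -> 0 <= f x.
Proof.
move=> x1; have x0 : 0 < x by lra.
have := ln_alpha_tangent ltr01 x0; rewrite ln_alpha1 div1r => le0.
apply: le_trans le0 _; rewrite gerDl mulr_ge0_le0 ?powR_ge0 // subr_le0.
by rewrite invf_le1.
Qed.

Lemma ln_alphaM_le x y : 1 <= x -> 1 <= y -> f (x * y) <= f x + f y.
Proof.
move=> x1 y1; rewrite ln_alphaM; [|lra|lra].
rewrite lerD2l ler_piMl ?ln_alpha_ge0 //.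
by rewrite -[leRHS](powRr0 x) ler_powR // subr_le0.
Qed.

(** The entropy estimate. Write [P] for the sum and [p j = x j / P]. By
    [ln_alphaM_le], [ln_alpha P <= ln_alpha (x j) + ln_alpha (1 / p j)]; averaging
    over [j] with weights [p j] leaves the mean of [ln_alpha (1 / p j)], which is
    at most [ln_alpha #|D|]. That last bound is Jensen's inequality, here obtained
    by summing the tangent lines at [#|D|], whose linear parts cancel. Vanishing
    [x j] are allowed so that the lemma applies to minors with permanent 0. *)
Lemma ln_alpha_sum_le (I : finType) (D : {set I}) (x : I -> R) :
    (forall j, j \in D -> x j = 0 \/ 1 <= x j) ->
  (\sum_(j in D) x j) * f (\sum_(j in D) x j) <=
  (\sum_(j in D) x j) * f #|D|%:R + \sum_(j in D) x j * f (x j).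
Proof.
move=> x01; set P := \sum_(j in D) x j; pose r : R := #|D|%:R.
have x_ge0 j : j \in D -> 0 <= x j by case/x01 => [->|/(le_trans ler01)].
have P_ge0 : 0 <= P by apply: sumr_ge0.
have [D0|D_gt0] := posnP #|D|.
  by rewrite /P !(big_pred0 _ _ _ _ (card0_eq D0)) !mul0r addr0.
have r_gt0 : 0 < r by rewrite ltr0n.
pose c := r `^ (1 - alpha).
(* the error term [P / r - x j] of the tangent line at r sums to 0 over D *)
have pointwise j : j \in D ->
    x j * f P <= x j * f r + x j * f (x j) + c * (P / r - x j).
  move=> jD; case: (x01 _ jD) => [->|xj1].
    by rewrite !mul0r !add0r subr0 mulr_ge0 ?powR_ge0 // divr_ge0 // ltW.
  have xj0 : 0 < x j by lra.
  have xjP : x j <= P.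
    by rewrite /P (bigD1 j) //= lerDl sumr_ge0 // => k /andP[kD _]; exact: x_ge0.
  have q1 : 1 <= P / x j by rewrite ler_pdivlMr // mul1r.
  have split : f P <= f (x j) + f (P / x j).
    by rewrite -{1}(@divfK _ (x j) _ P) ?gt_eqF // mulrC ln_alphaM_le.
  have tangent := ln_alpha_tangent (lt_le_trans ltr01 q1) r_gt0.
  have -> : c * (P / r - x j) = x j * (c * (P / x j / r - 1)).
    by field; rewrite !gt_eqF.
  by rewrite -!mulrDr (ler_wpM2l (ltW xj0)) //; move: tangent; rewrite -/c; lra.
rewrite {1 2}/P 2!mulr_suml.
apply: le_trans (ler_sum _ pointwise) _.
rewrite !big_split /= -mulr_sumr sumrB sumr_const -/P -/r.
rewrite -mulr_natr -/r divfK ?gt_eqF // subrr mulr0 addr0.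
by rewrite lerD2r.
Qed.

End LnAlpha.

(** * Permanents and their expansion along a row *)

Lemma permanent0 (R : comPzSemiRingType) (A : 'M[R]_0) : permanent A = 1.
Proof.
rewrite /permanent (big_pred1 1%g) ?big_ord0 // => s.
by apply/esym/eqP/permP; case.
Qed.

Lemma permanent01_eq0_or_ge1 (R : realType) n (A : 'M[R]_n) :
  (forall i j, A i j = 0 \/ A i j = 1) -> permanent A = 0 \/ 1 <= permanent A.
Proof.
move=> A01.
have /natrP[m ->] : permanent A \is a Num.nat.
  apply: rpred_sum => s _; apply: rpred_prod => i _.
  by case: (A01 i (s i)) => ->; rewrite ?rpred0 ?rpred1.
by case: m => [|m]; [left | right; rewrite ler1n].
Qed.

(** With [lift_perm_inj]: [lift_perm i j] is a bijection from ['S_n] onto the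
    permutations that send [i] to [j]. *)
Lemma lift_perm_surj n (i : 'I_n.+1) (s : 'S_n.+1) :
  exists t : 'S_n, s = lift_perm i (s i) t.
Proof.
have lift_ex k : exists l, s (lift i k) == lift (s i) l.
  have : s i != s (lift i k) by rewrite (inj_eq perm_inj) neq_lift.
  by case/unlift_some => l -> _; exists l.
pose t k := xchoose (lift_ex k).
have tE k : lift (s i) (t k) = s (lift i k).
  by apply/esym/eqP/(xchooseP (lift_ex k)).
have t_inj : injective t.
  by move=> k l /(congr1 (lift (s i))); rewrite !tE => /perm_inj/lift_inj.
exists (perm t_inj); apply/permP => k.
case: (unliftP i k) => [l|] ->; last by rewrite lift_perm_id.
by rewrite lift_perm_lift permE tE.
Qed.

Lemma lift_perm_inj n (i j : 'I_n.+1) : injective (@lift_perm n i j).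
Proof.
move=> s t est; apply/permP => k; apply: (@lift_inj _ j).
by rewrite -!(lift_perm_lift i j) est.
Qed.

Lemma prod_lift_perm (R : comPzSemiRingType) n (A : 'M[R]_n.+1) i j (t : 'S_n) :
  \prod_k A k (lift_perm i j t k) = A i j * \prod_k row' i (col' j A) k (t k).
Proof.
rewrite (bigD1_ord i) //= lift_perm_id; congr (_ * _).
by apply: eq_bigr => k _; rewrite !mxE lift_perm_lift.
Qed.

(** Laplace expansion along row [i] with an extra weight depending on the image
    of [i]. The case [h = 1] is the usual expansion; the general case turns sums
    over the positions of a row, weighted by minors, back into sums over
    permutations, which makes the expansions along different rows comparable. *)
Lemma permanent_expand_row (R : comPzSemiRingType) n (A : 'M[R]_n.+1) i
    (h : 'I_n.+1 -> R) :
  \sum_(s : 'S_n.+1) (\prod_k A k (s k)) * h (s i) =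
  \sum_j A i j * permanent (row' i (col' j A)) * h j.
Proof.
rewrite (partition_big (fun s : 'S_n.+1 => s i) predT) //=.
apply: eq_bigr => j _; rewrite /permanent mulr_sumr mulr_suml.
under [RHS]eq_bigr do rewrite -prod_lift_perm.
rewrite -(big_imset (fun s : 'S_n.+1 => (\prod_k A k (s k)) * h j)) /=; last first.
  by move=> s t _ _ /lift_perm_inj.
apply: eq_big => [s|s /eqP-> //].
apply/eqP/imsetP => [<-|[t _ ->]]; last by rewrite lift_perm_id.
by have [t ->] := lift_perm_surj i s; exists t; rewrite ?lift_perm_id.
Qed.

(** * Averaging the row expansions *)

Definition mean_ln (R : realType) (alpha : R) (r : nat) : R :=
  r%:R^-1 * \sum_(1 <= j < r.+1) ln_alpha alpha j%:R.

(** At [r = 0] the conventional value of [mean_ln alpha 0] is multiplied by 0. *)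
Lemma mean_lnS (R : realType) (alpha : R) r :
  r.+1%:R * mean_ln alpha r.+1 =
  ln_alpha alpha r.+1%:R + r%:R * mean_ln alpha r.
Proof.
rewrite /mean_ln mulVKf ?pnatr_eq0 // big_nat_recr //= addrC; congr (_ + _).
by case: r => [|r]; [rewrite big_geq // !mulr0 | rewrite mulVKf ?pnatr_eq0].
Qed.

(** The double count for one row whose ones are in the columns [D] and which the
    permutation sends to [j0]. When another row is expanded at the column [j],
    this row loses a one exactly if [j] is in [D]. Over all [j != j0] this happens
    [#|D| - 1] times, and the term [ln_alpha alpha #|D|%:R], which comes from
    expanding the row itself, compensates for the loss by [mean_lnS]. *)
Lemma mean_ln_double_count (R : realType) (alpha : R) n (D : {set 'I_n.+1}) j0 :
    j0 \in D ->
  ln_alpha alpha #|D|%:R +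
    \sum_(j | j != j0) mean_ln alpha (#|D| - (j \in D)) =
  n.+1%:R * mean_ln alpha #|D|.
Proof.
move=> j0D; set g := mean_ln alpha.
have cardD : (#|D| + #|~: D|)%N = n.+1 by rewrite cardsC card_ord.
have [r rE] : exists r, #|D| = r.+1.
  by exists #|D|.-1; rewrite prednK // card_gt0; apply/set0Pn; exists j0.
have total : \sum_j g (#|D| - (j \in D))%N =
    #|D|%:R * g r + #|~: D|%:R * g #|D|.
  rewrite (bigID (mem D)) /= !mulr_natl -!sumr_const; congr (_ + _).
    by apply: eq_bigr => j ->; rewrite rE subn1.
  by apply: eq_big => [j|j /negPf ->]; rewrite ?inE // subn0.
move: total; rewrite (bigD1 j0) //= j0D rE subn1 /= => total.
have := mean_lnS alpha r; rewrite -/g => gS.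
have -> : n.+1%:R = r.+1%:R + #|~: D|%:R :> R by rewrite -natrD -rE cardD.
move: total gS; rewrite -natr1 !mulrDl !mul1r; lra.
Qed.

Lemma row_ones_minor (R : nzRingType) n (A : 'M[R]_n.+1) i j k :
  row_ones (row' i (col' j A)) k =
  (row_ones A (lift i k) - (A (lift i k) j == 1%R))%N.
Proof.
have row_onesE m (B : 'M[R]_m) l : row_ones B l = (\sum_c (B l c == 1%R))%N.
  by rewrite /row_ones -sum1dep_card big_mkcond.
rewrite !row_onesE (bigD1_ord j) //= addKn.
by apply: eq_bigr => l _; rewrite !mxE.
Qed.

(** The factor [permanent A] makes the inequality hold also for minors with
    permanent 0, so that the induction hypothesis applies to every minor. *)
Lemma permanent_ln_le (R : realType) (alpha : R) (alpha_ge1 : 1 <= alpha)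
    n (A : 'M[R]_n) (A01 : forall i j, A i j = 0 \/ A i j = 1) :
  permanent A * ln_alpha alpha (permanent A) <=
  permanent A * \sum_i mean_ln alpha (row_ones A i).
Proof.
elim: n A A01 => [|n IHn] A A01.
  by rewrite permanent0 ln_alpha1 big_ord0.
pose f := ln_alpha alpha; pose g := mean_ln alpha.
pose P := permanent A; pose w (s : 'S_n.+1) := \prod_k A k (s k).
pose D k := [set c | A k c == 1]; pose r k := row_ones A k.
pose M i j := permanent (row' i (col' j A)).
have minor01 i j k l : row' i (col' j A) k l = 0 \/ row' i (col' j A) k l = 1.
  by rewrite !mxE.
have sum_row i (F : 'I_n.+1 -> R) : \sum_(j in D i) F j = \sum_j A i j * F j.
  rewrite big_mkcond; apply: eq_bigr => j _; rewrite inE.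
  by case: (A01 i j) => ->; rewrite ?eqxx ?mul1r // eq_sym oner_eq0 mul0r.
have sum_neq i (F : 'I_n.+1 -> R) :
    \sum_(k | k != i) F k = \sum_(k < n) F (lift i k).
  apply: (@addrI _ (F i)); transitivity (\sum_k F k).
    by rewrite [RHS](bigD1 i).
  by rewrite [LHS](bigD1_ord i).
have P_row i : P = \sum_(j in D i) M i j.
  have := permanent_expand_row A i (fun=> 1).
  under eq_bigr do rewrite mulr1; under [RHS]eq_bigr do rewrite mulr1.
  by rewrite sum_row.
pose h i j := \sum_(k | k != i) g (r k - (j \in D k))%N.
(* one row: the entropy estimate, with the induction hypothesis on the minors *)
have row_bound i : P * f P <= \sum_s w s * (f (r i)%:R + h i (s i)).
  under eq_bigr do rewrite mulrDr.
  rewrite big_split /= -mulr_suml -/P permanent_expand_row.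
  have := ln_alpha_sum_le alpha_ge1
    (fun j (_ : j \in D i) => permanent01_eq0_or_ge1 (minor01 i j)).
  rewrite -(P_row i) => /le_trans; apply; rewrite lerD2l.
  under [leRHS]eq_bigr do rewrite -mulrA.
  rewrite -sum_row; apply: ler_sum => j _.
  apply: le_trans (IHn _ (minor01 i j)) _.
  rewrite -/(M i j) /h sum_neq; under eq_bigr do rewrite row_ones_minor.
  by under [in leRHS]eq_bigr do rewrite inE.
(* only permutations supported by the ones of A carry weight, and for these the
   double count applies to each row k, with j0 = s k *)
have weight_mean s : w s * \sum_i (f (r i)%:R + h i (s i)) =
    w s * (n.+1%:R * \sum_k g (r k)).
  have [->|w_neq0] := eqVneq (w s) 0; first by rewrite !mul0r.
  congr (_ * _); rewrite big_split /= (exchange_big_dep predT) //= -big_split /=.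
  rewrite mulr_sumr; apply: eq_bigr => k _.
  have skD : s k \in D k.
    rewrite inE; case: (A01 k (s k)) => Aks; last by rewrite Aks.
    by case/eqP: w_neq0; rewrite /w (bigD1 k) //= Aks mul0r.
  rewrite -(mean_ln_double_count alpha skD) [in RHS](reindex_perm s) /=.
  congr (_ + _); apply: eq_big => [i|//].
  by rewrite (inj_eq perm_inj) eq_sym.
rewrite -/P -/f -/g -(@ler_pM2l _ n.+1%:R) ?ltr0n //.
have -> : n.+1%:R * (P * f P) = \sum_(i < n.+1) P * f P.
  by rewrite sumr_const card_ord mulr_natl.
apply: le_trans (ler_sum _ (fun i _ => row_bound i)) _.
rewrite exchange_big /=.
under eq_bigr do rewrite -mulr_sumr weight_mean.
by rewrite -mulr_suml mulrCA.
Qed.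

Theorem proposition9 (R : realType) (n : nat) (A : 'M[R]_n)
    (A01 : forall i j, A i j = 0 \/ A i j = 1)
    (perA : permanent A <> 0)
    (rA : forall i, row_ones A i <> 0%N)
    (alpha : R) (alpha_ge1 : 1 <= alpha) :
  ln_alpha alpha (permanent A) <=
    \sum_(i < n) (row_ones A i)%:R^-1 *
      \sum_(1 <= j < (row_ones A i).+1) ln_alpha alpha j%:R.
Proof.
have [//|per_ge1] := permanent01_eq0_or_ge1 A01.
have per_gt0 : 0 < permanent A by exact: lt_le_trans ltr01 per_ge1.
by rewrite -(ler_pM2l per_gt0); exact: permanent_ln_le.
Qed.
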